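(* Let $H$ be a real Hilbert space, let $K_1,\ldots,K_N$ be closed convex subsets of $H$ with $\bigcap_{i=1}^N K_i\neq\emptyset$, and let $f_1,\ldots,f_N:H\times H\to\mathbb{R}$ be bifunctions each satisfying conditions (A1)-(A4) of the context, with the same constants $c_1,c_2>0$ in (A2) for all $i$. Assume that the solution set $F=\bigcap_{i=1}^N EP(f_i)$ is nonempty. Let $x_0\in H$ and let $\{x_n\}$, $\{y_n^i\}$, $\{z_n^i\}$ ($i=1,\ldots,N$) be the (infinite) sequences generated by the parallel hybrid extragradient-cutting algorithm described in the context. Then $\{x_n\}$ and, for every $i=1,\ldots,N$, $\{y_n^i\}$ and $\{z_n^i\}$ converge strongly to $P_F(x_0)$.
   Context: $P_C$ denotes the metric projection of $H$ onto a nonempty closed convex set $C$. For each $i$, $EP(f_i)$ is the set of $x^*\in K_i$ such that $f_i(x^*,y)\ge 0$ for all $y\in K_i$. Conditions on each $f_i$: (A1) $f_i$ is pseudomonotone on $H$: for all $x,y\in H$, $f_i(x,y)\ge 0$ implies $f_i(y,x)\le 0$. (A2) $f_i$ is Lipschitz-type continuous: $f_i(x,y)+f_i(y,z)\ge f_i(x,z)-c_1\|x-y\|^2-c_2\|y-z\|^2$ for all $x,y,z\in H$, with constants $c_1,c_2>0$. (A3) $f_i$ is weakly continuous on $H\times H$ (if $x_n\rightharpoonup x$ and $y_n\rightharpoonup y$ weakly in $H$, then $f_i(x_n,y_n)\to f_i(x,y)$). (A4) For every fixed $x\in H$, $f_i(x,\cdot)$ is convex and subdifferentiable on $H$. Parallel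 hybrid extragradient-cutting algorithm. Parameters: real numbers $\lambda,\mu$, $\epsilon\in(0,\frac12]$, and $\lambda_n^i,\gamma_n^i$ with $0<\lambda\le\lambda_n^i\le\mu<\min\{\frac{1}{2c_1},\frac{1}{2c_2}\}$ and $\gamma_n^i\in[\epsilon,\frac12]$, for all $n\ge0$ and $i=1,\ldots,N$. Start with $x_0\in H$ and $n=0$. Step 1. For $i=1,\ldots,N$: $y_n^i=\arg\min\{\lambda_n^i f_i(x_n,y)+\frac12\|x_n-y\|^2: y\in K_i\}$. Step 2. For $i=1,\ldots,N$: $z_n^i=\arg\min\{\lambda_n^i f_i(y_n^i,y)+\frac12\|x_n-y\|^2: y\in K_i\}$. Step 3. $x_{n+1}=P_{H_n\cap W_n}(x_0)$, where $H_n=\bigcap_{i=1}^N H_n^i$, $H_n^i=\{z\in H:\langle x_n-z_n^i,\, z-x_n-\gamma_n^i(z_n^i-x_n)\rangle\le 0\}$, and $W_n=\{z\in H:\langle x_0-x_n,\, x_n-z\rangle\ge 0\}$. Step 4. If $x_{n+1}=x_n$, stop; otherwise replace $n$ by $n+1$ and go to Step 1. *)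

(* Defs.v *)
From HB Require Import structures.
From mathcomp Require Import all_boot all_order all_algebra sesquilinear.
From mathcomp Require Import all_classical all_reals all_analysis.

Set Implicit Arguments.
Unset Strict Implicit.
Unset Printing Implicit Defensive.

Import Order.TTheory GRing.Theory Num.Theory.
Import numFieldNormedType.Exports.

Local Open Scope classical_set_scope.
Local Open Scope ring_scope.

(* A real Hilbert space is a [completeNormedModType R] together with a symmetric
   positive definite bilinear form [dot : {dot H for idfun}] inducing its norm. *)
Definition induces_norm (R : realType) (H : normedModType R)
    (dot : {dot H for idfun}) : Prop :=
  forall u : H, dot u u = `|u| ^+ 2.

Definition weak_cvg (R : realType) (H : normedModType R)
    (dot : {dot H for idfun}) (u : nat -> H) (l : H) : Prop :=
  forall v : H, dot (u n) v @[n --> \oo] --> dot l v.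

Definition is_argmin (R : realType) (T : Type) (A : set T) (g : T -> R) (p : T) :
    Prop :=
  A p /\ forall y, A y -> g p <= g y.

(* The graph of the metric projection: [is_proj C x p] reads p = P_C(x). *)
Definition is_proj (R : realType) (H : normedModType R) (C : set H) (x p : H) :
    Prop :=
  is_argmin C (fun z => `|x - z|) p.

Definition EP (R : realType) (H : normedModType R) (K : set H) (f : H -> H -> R) :
    set H :=
  [set x | K x /\ forall y, K y -> 0 <= f x y].

Definition pseudomonotone (R : realType) (H : normedModType R)
    (f : H -> H -> R) : Prop :=
  forall x y, 0 <= f x y -> f y x <= 0.

Definition lipschitz_type (R : realType) (H : normedModType R) (c1 c2 : R)
    (f : H -> H -> R) : Prop :=
  forall x y z,
    f x z - c1 * `|x - y| ^+ 2 - c2 * `|y - z| ^+ 2 <= f x y + f y z.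

Definition weakly_continuous (R : realType) (H : normedModType R)
    (dot : {dot H for idfun}) (f : H -> H -> R) : Prop :=
  forall (u v : nat -> H) (x y : H), weak_cvg dot u x -> weak_cvg dot v y ->
    f (u n) (v n) @[n --> \oo] --> f x y.

Definition subdifferential (R : realType) (H : normedModType R)
    (dot : {dot H for idfun}) (g : H -> R) (x : H) : set H :=
  [set w | forall z, g x + dot w (z - x) <= g z].

Definition subdifferentiable (R : realType) (H : normedModType R)
    (dot : {dot H for idfun}) (g : H -> R) : Prop :=
  forall x, subdifferential dot g x !=set0.

(* The objective y |-> l f(a, y) + |x - y|^2 / 2 of the two minimization steps. *)
Definition prox_objective (R : realType) (H : normedModType R)
    (f : H -> H -> R) (l : R) (x a : H) (y : H) : R :=
  l * f a y + 2^-1 * `|x - y| ^+ 2.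

(* The half-space H_n^i, for x = x_n, z = z_n^i and g = gamma_n^i. *)
Definition cut_halfspace (R : realType) (H : normedModType R)
    (dot : {dot H for idfun}) (x z : H) (g : R) : set H :=
  [set w | dot (x - z) (w - x - g *: (z - x)) <= 0].

(* The half-space W_n, for x = x_n. *)
Definition outer_halfspace (R : realType) (H : normedModType R)
    (dot : {dot H for idfun}) (x0 x : H) : set H :=
  [set w | 0 <= dot (x0 - x) (x - w)].

(* [x], [y], [z] is an infinite run from [x0], i.e. one which never meets the
   stopping test x_{n+1} = x_n. *)
Record hybrid_extragradient_cutting (R : realType) (H : normedModType R)
    (dot : {dot H for idfun}) (N : nat) (K : 'I_N -> set H)
    (f : 'I_N -> H -> H -> R) (lam gam : 'I_N -> nat -> R) (x0 : H)
    (x : nat -> H) (y z : 'I_N -> nat -> H) : Prop :=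
  HybridExtragradientCutting {
    hec_start : x 0%N = x0 ;
    hec_step1 : forall n i,
      is_argmin (K i) (prox_objective (f i) (lam i n) (x n) (x n)) (y i n) ;
    hec_step2 : forall n i,
      is_argmin (K i) (prox_objective (f i) (lam i n) (x n) (y i n)) (z i n) ;
    hec_step3 : forall n,
      is_proj ((\bigcap_i cut_halfspace dot (x n) (z i n) (gam i n)) `&`
               outer_halfspace dot x0 (x n)) x0 (x n.+1) ;
    hec_step4 : forall n, x n.+1 <> x n
  }.

(* Main.v *)
(* By convexity, the two proximal steps and the Lipschitz-type condition give
   |z - p|^2 <= |x - p|^2 - (1 - 2 l c1) |x - y|^2 for every solution p.  Hence all
   solutions stay in H_n, and in W_n by the variational characterization of the
   projection.  So |x_n - x_0| is nondecreasing and bounded, |x_{n+1} - x_n| tends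
   to 0, and x_{n+1} in H_n turns this into |x_n - z_n| -> 0, then |x_n - y_n| -> 0.
   A weak cluster point l of (x_n) solves all the equilibrium problems by weak
   continuity, and weak lower semicontinuity gives |x_0 - l| <= sup |x_0 - x_n|,
   which is at most |x_0 - p| for every solution p: so l is the projection.
   Finally l in W_n reads |x_n - l|^2 <= |x_0 - l|^2 - |x_0 - x_n|^2, so the whole
   sequence converges strongly. *)
Require Import Defs.
From HB Require Import structures.
From mathcomp Require Import all_boot all_order all_algebra sesquilinear.
From mathcomp Require Import all_classical all_reals all_analysis.
From mathcomp Require Import ring lra.

Set Implicit Arguments.
Unset Strict Implicit.
Unset Printing Implicit Defensive.

Import Order.TTheory GRing.Theory Num.Theory.
Import numFieldNormedType.Exports.

Local Open Scope classical_set_scope.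
Local Open Scope ring_scope.

(** * Inner product algebra, weak convergence and variational inequalities *)

Section InnerProduct.
Variables (R : realType) (H : normedModType R) (dot : {dot H for idfun}).
Hypothesis hdot : induces_norm dot.
Implicit Types (u v w x p : H) (a b : R) (C : set H).

Lemma dotC u v : dot u v = dot v u.
Proof. by rewrite (hermC dot) /= expr0 mul1r. Qed.

Lemma dotZl a u v : dot (a *: u) v = a * dot u v.
Proof. exact: linearZl_LR. Qed.

Lemma dotZr a u v : dot u (a *: v) = a * dot u v.
Proof. exact: linearZr_LR. Qed.

Lemma dotDl u v w : dot (u + v) w = dot u w + dot v w.
Proof. exact: linearDl. Qed.

Lemma dotBl u v w : dot (u - v) w = dot u w - dot v w.
Proof. exact: linearBl. Qed.

Lemma dotDr u v w : dot w (u + v) = dot w u + dot w v.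
Proof. exact: linearDr. Qed.

Lemma dot0l u : dot 0 u = 0.
Proof. exact: linear0l. Qed.

Lemma dot0r u : dot u 0 = 0.
Proof. exact: linear0r. Qed.

Lemma dotNl u v : dot (- u) v = - dot u v.
Proof. exact: linearNl. Qed.

Lemma dotNr u v : dot u (- v) = - dot u v.
Proof. exact: linearNr. Qed.

Definition dotE := (dotDl, dotDr, dotNl, dotNr, dotZl, dotZr).

Lemma dot_ge0 u : 0 <= dot u u.
Proof. by rewrite hdot sqr_ge0. Qed.

Lemma dot_eq0 u : dot u u = 0 -> u = 0.
Proof. by rewrite hdot => /eqP; rewrite sqrf_eq0 normr_eq0 => /eqP. Qed.

(** The vector [dot v v *: u - dot u v *: v] has a nonnegative square, which is [dot v v] times the
    difference of the squared sides. *)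
Lemma cauchy_schwarz u v : `|dot u v| <= `|u| * `|v|.
Proof.
rewrite -ler_sqr ?nnegrE ?mulr_ge0// real_normK ?num_real// exprMn -!hdot.
have [v0|v0] := eqVneq (dot v v) 0.
  by rewrite v0 mulr0 (dot_eq0 v0) dot0r expr0n.
have vpos : 0 < dot v v by rewrite lt_def v0 dot_ge0.
have := dot_ge0 (dot v v *: u - dot u v *: v); rewrite !dotE (dotC v u).
rewrite [X in 0 <= X](_ : _ = dot v v * (dot u u * dot v v - dot u v ^+ 2)).
  by rewrite pmulr_rge0// subr_ge0.
by ring.
Qed.

Lemma dot_cvgl (T : Type) (F : set_system T) (FF : Filter F) (u : T -> H) l v :
  u t @[t --> F] --> l -> dot (u t) v @[t --> F] --> dot l v.
Proof.
move=> ul; apply/cvgrPdist_le => e e0.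
have d0 : 0 < e / (`|v| + 1) by rewrite divr_gt0// ltr_wpDl.
move/cvgrPdist_le : ul => /(_ _ d0); apply: filterS => t ht.
rewrite -dotBl (le_trans (cauchy_schwarz _ _))//.
apply: (@le_trans _ _ (e / (`|v| + 1) * (`|v| + 1))); last first.
  by rewrite divfK// gt_eqF// ltr_wpDl.
by rewrite ler_pM// lerDl.
Qed.

Lemma strong_weak_cvg (u : nat -> H) l :
  u n @[n --> \oo] --> l -> weak_cvg dot u l.
Proof. by move=> ul v; exact: dot_cvgl. Qed.

Lemma cst_weak_cvg l : weak_cvg dot (fun=> l) l.
Proof. by apply: strong_weak_cvg; exact: cvg_cst. Qed.

Lemma weak_cvg_dist0 (u v : nat -> H) l :
  weak_cvg dot u l -> `|v n - u n| @[n --> \oo] --> 0 -> weak_cvg dot v l.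
Proof.
move=> ul uv w.
rewrite (_ : (fun n => _) = fun n => dot (u n) w + dot (v n - u n) w); last first.
  by apply/funext => n; rewrite -dotDl addrC subrK.
rewrite -[dot l w]addr0 -(dot0l w); apply: cvgD (ul w) _.
by apply: dot_cvgl; exact: norm_cvg0.
Qed.

Lemma convex_setE C : convex_set C -> forall u v t, 0 <= t <= 1 ->
  C u -> C v -> C (t *: u + (1 - t) *: v).
Proof.
move=> cC u v t /andP[t0 t1] Cu Cv.
by have := cC u v (Itv01 t0 t1); rewrite !inE => /(_ Cu Cv).
Qed.

(* First-order optimality: test p against p + t (w - p) and let t go to 0. *)
Lemma argmin_prox_variational (C : set H) (g : H -> R) x p :
  convex_set C -> convex_function [set: H] g ->
  is_argmin C (fun y => g y + 2^-1 * `|x - y| ^+ 2) p ->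
  forall w, C w -> dot (x - p) (w - p) <= g w - g p.
Proof.
move=> cC cg [Cp minp] w Cw; apply/ler_addgt0Pr => e e0.
pose d := `|w - p| ^+ 2; have d_ge0 : 0 <= d by exact: sqr_ge0.
(* This [t] lies in (0, 1] and satisfies [t * d <= e], so after division by [t] the quadratic term
   costs at most [e / 2]. The [e] in the denominator covers [d = 0]. *)
pose t := e / (d + e).
have de_gt0 : 0 < d + e by exact: ltr_wpDl.
have t_gt0 : 0 < t by exact: divr_gt0.
have t01 : 0 <= t <= 1 by rewrite ltW//= /t ler_pdivrMr// mul1r lerDr.
have td : t * d <= e.
  by rewrite /t mulrAC ler_pdivrMr// ler_pM2l// lerDl ltW.
have [s st] : exists s : {i01 R}, s%:num = t.
  by exists (@Itv01 _ _ (proj1 (andP t01)) (proj2 (andP t01))).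
have := cC w p s; rewrite !inE => /(_ Cw Cp) /minp /=.
have := cg s w p; rewrite !inE => /(_ I I).
have -> : conv s (w : convex_lmodType H) p = p + t *: (w - p).
  by rewrite /conv /= st /unstable.onem scalerBl scale1r scalerBr addrCA.
rewrite [X in _ <= X](_ : _ = t * g w + (1 - t) * g p); last by rewrite -st.
have -> : `|x - (p + t *: (w - p))| ^+ 2 =
    `|x - p| ^+ 2 - 2 * (t * dot (x - p) (w - p)) + t * (t * d).
  by rewrite /d -!hdot !dotE (dotC p x) (dotC w x) (dotC p w); ring.
have te_gt0 : 0 < t * e by exact: mulr_gt0.
move: td; rewrite -(ler_pM2l t_gt0) => td gc gm; rewrite -(ler_pM2l t_gt0); lra.
Qed.

(** A projection is a proximal point of the zero function, since the distance and half its square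
    have the same minimizers. *)
Lemma proj_variational C x p : convex_set C -> is_proj C x p ->
  forall w, C w -> dot (x - p) (w - p) <= 0.
Proof.
move=> cC [Cp minp] w Cw; rewrite -[leRHS](subrr 0).
apply: (@argmin_prox_variational C (fun=> 0)) => //.
  by move=> t a b _ _; rewrite convmm.
split=> // y Cy; rewrite !add0r ler_pM2l ?invr_gt0// ler_sqr ?nnegrE//.
exact: minp.
Qed.

End InnerProduct.

(** * Existence of projections, Riesz representation, and weak closedness of closed convex sets *)

Section Projection.
Variables (R : realType) (H : completeNormedModType R) (dot : {dot H for idfun}).
Hypothesis hdot : induces_norm dot.
Implicit Types (u v w x p l : H) (C : set H).

(** A minimizing sequence is Cauchy by the parallelogram law, because midpoints stay in [C];
    completeness supplies its limit. *)
Lemma proj_exists C x : closed C -> convex_set C -> C !=set0 ->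
  exists p, is_proj C x p.
Proof.
move=> clC cC [c Cc].
pose D := [set `|x - y| ^+ 2 | y in C].
have D_inf : has_inf D.
  split; first by exists (`|x - c| ^+ 2), c.
  by exists 0 => _ [y _ <-]; exact: sqr_ge0.
have D_lb y : C y -> inf D <= `|x - y| ^+ 2.
  by move=> Cy; apply: ge_inf; [exact: D_inf.2 | exists y].
have approx n : exists y, C y /\ `|x - y| ^+ 2 < inf D + n.+1%:R^-1.
  have n0 : 0 < n.+1%:R^-1 :> R by rewrite invr_gt0.
  have [_ [y Cy <-] ylt] := inf_adherent n0 D_inf.
  by exists y.
have [y /all_and2[Cy ylt]] := choice approx.
have Cmid a b : C a -> C b -> C (2^-1 *: (a + b)).
  move=> Ca Cb; have -> : 2^-1 *: (a + b) = 2^-1 *: a + (1 - 2^-1) *: b.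
    by rewrite scalerDr; congr (_ + _ *: _); lra.
  by apply: convex_setE => //; lra.
(* The left side is twice the sum of the two squared distances to [x] minus four times that of the
   midpoint, so the infimum cancels and only the two error terms remain. *)
have close n m : (n <= m)%N -> `|y n - y m| ^+ 2 <= 4 * n.+1%:R^-1.
  move=> nm; have := D_lb _ (Cmid _ _ (Cy n) (Cy m)).
  have := ylt n; have := ylt m.
  have : m.+1%:R^-1 <= n.+1%:R^-1 :> R by rewrite lef_pV2 ?posrE// ler_nat.
  rewrite -!hdot !(dotE dot) (dotC dot (y n) x) (dotC dot (y m) x).
  rewrite (dotC dot (y m) (y n)).
  by move: (inf D) n.+1%:R^-1 m.+1%:R^-1 => d en em; lra.
have cy : cauchy (y n @[n --> \oo]).
  apply: cauchy_exP => e e0.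
  have e4 : 0 < e ^+ 2 / 4 by rewrite divr_gt0// exprn_gt0.
  have [n _ /(_ n (leqnn n)) /= ne] := near_infty_natSinv_lt (PosNum e4).
  exists (y n).
  exists n => // m /= nm; rewrite -ball_normE /=.
  rewrite -ltr_sqr ?nnegrE// ?(ltW e0)//; have := close _ _ nm.
  by move: ne; move: n.+1%:R^-1 => d; lra.
have /cvg_ex[p yp] : cvg (y n @[n --> \oo]) by apply/cauchy_cvgP.
exists p; split; first by apply: (closed_cvg C clC _ p yp); exact: nearW.
move=> w Cw; rewrite -ler_sqr ?nnegrE// (le_trans _ (D_lb _ Cw))//.
have xy : `|x - y n| ^+ 2 @[n --> \oo] --> `|x - p| ^+ 2.
  under eq_fun do rewrite expr2; rewrite expr2.
  by apply: cvgM; apply: cvg_norm; apply: cvgB => //; exact: cvg_cst.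
have yd : (inf D + @harmonic R n) @[n --> \oo] --> inf D.
  rewrite -[X in _ --> X]addr0; apply: cvgD; [exact: cvg_cst | exact: cvg_harmonic].
by apply: (ler_cvg_to xy yd); apply: nearW => n; exact/ltW/ylt.
Qed.

(** For nonzero [L], the projection [q] of 0 onto the hyperplane [L = 1] is orthogonal to the kernel
    of [L], so a multiple of [q] represents [L]. *)
Lemma riesz (L : H -> R) (M : R) : scalar L -> (forall v, `|L v| <= M * `|v|) ->
  exists l, forall v, L v = dot l v.
Proof.
move=> linL bndL.
have L0 : L 0 = 0.
  apply/normr0_eq0/le_anti; rewrite normr_ge0 andbT.
  by rewrite (le_trans (bndL 0))// normr0 mulr0.
have LD u v : L (u + v) = L u + L v by have := linL 1 u v; rewrite scale1r mul1r.
have LZ a v : L (a *: v) = a * L v by have := linL a v 0; rewrite addr0 L0 addr0.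
have LB u v : L (u - v) = L u - L v by rewrite LD -scaleN1r LZ mulN1r.
have [Lz|/existsNP[v0 Lv0]] := pselect (forall v, L v = 0).
  by exists 0 => v; rewrite Lz dot0l.
pose C := [set v | L v = 1].
have C_closed : closed C.
  move=> v vcl; apply/eqP; rewrite -subr_eq0 -normr_le0; apply/ler_addgt0Pr => e e0.
  have M0 : 0 < `|M| + 1 by rewrite ltr_wpDl.
  have [w [Cw]] := vcl _ (nbhsx_ballx v (e / (`|M| + 1)) (divr_gt0 e0 M0)).
  rewrite -ball_normE /= ltr_pdivlMr// mulrC => vw.
  rewrite add0r -Cw -LB (le_trans (bndL _))// (le_trans _ (ltW vw))//.
  by rewrite ler_wpM2r// (le_trans (ler_norm _))// lerDl.
have C_convex : convex_set C.
  move=> a b t; rewrite !inE => Ca Cb; rewrite /conv /= /C /=.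
  by rewrite LD !LZ Ca Cb /unstable.onem; lra.
have [q [Cq minq]] : exists q, is_proj C 0 q.
  apply: proj_exists => //; exists ((L v0)^-1 *: v0).
  by rewrite /C /= LZ mulVf//; apply/eqP.
(* Both [q + w] and [q - w] lie in the hyperplane, so the variational inequality holds with both
   signs. *)
have qker w : L w = 0 -> dot q w = 0.
  move=> Lw; have /(_ _ _) var := proj_variational hdot C_convex (conj Cq minq).
  have := var (q + w); have := var (q - w).
  rewrite /C /= LB LD Lw subr0 addr0 => /(_ Cq) + /(_ Cq).
  by rewrite !(dotE dot) !(dot0l dot); lra.
have qq : dot q q != 0.
  apply/eqP => /(dot_eq0 hdot) q0; move: Cq; rewrite q0 /C /= L0 => /eqP.
  by rewrite eq_sym oner_eq0.
exists ((dot q q)^-1 *: q) => v.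
have : dot q (v - L v *: q) = 0 by apply: qker; rewrite LB LZ Cq mulr1 subrr.
rewrite !(dotE dot) => /subr0_eq ->.
by rewrite mulrCA mulVf// mulr1.
Qed.

(** With [q] the projection of [l] on [C], the inequality [dot (u n - q) (l - q) <= 0] passes to the
    weak limit and forces [l = q]. *)
Lemma closed_convex_weak_closed C (u : nat -> H) l : closed C -> convex_set C ->
  (forall n, C (u n)) -> weak_cvg dot u l -> C l.
Proof.
move=> clC cC Cu ul.
have [q pq] : exists q, is_proj C l q by apply: proj_exists => //; exists (u 0%N).
suff /dot_eq0 : dot (l - q) (l - q) = 0.
  by move=> /(_ hdot)/subr0_eq ->; exact: pq.1.
apply/le_anti; rewrite dot_ge0// andbT -subr_le0 subr0.
have lim : dot (u n) (l - q) - dot q (l - q) @[n --> \oo] --> dot (l - q) (l - q).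
  by rewrite [X in _ --> X]dotBl; apply: cvgB; [exact: ul | exact: cvg_cst].
apply: (cvgr_to_le lim); apply: nearW => n.
by rewrite -dotBl dotC; exact: proj_variational pq _ _.
Qed.

End Projection.

(** * Weak sequential compactness of bounded sequences *)

Lemma ultra_fmap (T U : Type) (f : T -> U) (F : set_system T) :
  UltraFilter F -> UltraFilter (f @ F).
Proof.
move=> uF; split; first exact: fmap_proper_filter.
move=> G GF FG; apply/seteqP; split => // A GA.
have [//|FnA] := in_ultra_setVsetC (f @^-1` A) uF.
have GnA : G (~` A) by exact: FG.
by have [a []] := filter_ex (filterI GA GnA).
Qed.

Section WeakCompactness.
Variables (R : realType) (H : completeNormedModType R) (dot : {dot H for idfun}).
Hypothesis hdot : induces_norm dot.
Implicit Types (u : nat -> H) (v w l : H) (M : R).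

(** For each [v] the numbers [dot (u n) v] stay in a compact segment, hence converge along [U]. The
    limit is linear and bounded in [v], and Riesz represents it. *)
Lemma ultra_weak_limit u M (U : set_system nat) : UltraFilter U ->
  (forall n, `|u n| <= M) ->
  exists l, forall v, dot (u n) v @[n --> U] --> dot l v.
Proof.
move=> uU uM.
have lim_ex v : exists r : R, dot (u n) v @[n --> U] --> r.
  have := @segment_compact R (- (M * `|v|)) (M * `|v|).
  rewrite compact_ultra => /(_ _ (ultra_fmap (fun n => dot (u n) v) uU)) [].
    apply: (@filterE _ U) => n /=; rewrite in_itv /= -ler_norml.
    by rewrite (le_trans (cauchy_schwarz hdot _ _))// ler_wpM2r.
  by move=> r [_]; exists r.
have [L Llim] := choice lim_ex.
have linL : scalar L.
  move=> a v w; apply: (cvg_unique _ (Llim _)) => //=.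
  rewrite (_ : (fun n => _) = fun n => a * dot (u n) v + dot (u n) w); last first.
    by apply/funext => n; rewrite !(dotE dot).
  by apply: cvgD => //; apply: cvgM => //; exact: cvg_cst.
have bndL v : `|L v| <= M * `|v|.
  apply: (cvgr_to_le (cvg_norm (Llim v))); apply: nearW => n /=.
  by rewrite (le_trans (cauchy_schwarz hdot _ _))// ler_wpM2r.
have [l lE] := riesz hdot linL bndL.
by exists l => v; rewrite -lE.
Qed.

(** Boundedness makes the maps [dot (l - u n)] Lipschitz with the common constant [M + |l|], so a
    nearby test vector changes the error uniformly little in [n]. *)
Lemma weak_cvg_closed u l M : (forall n, `|u n| <= M) ->
  closed [set w | dot (u n) w @[n --> \oo] --> dot l w].
Proof.
move=> uM w wcl; apply/cvgrPdist_le => e e0 /=.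
pose B := M + `|l| + 1.
have B0 : 0 < B by rewrite ltr_wpDl// addr_ge0// (le_trans _ (uM 0%N)).
have e2 : 0 < e / 2 by rewrite divr_gt0.
have [w' [/= + ww']] := wcl _ (nbhsx_ballx w (e / 2 / B) (divr_gt0 e2 B0)).
move=> /cvgrPdist_le/(_ _ e2); apply: filterS => n un.
rewrite -ball_normE /= ltr_pdivlMr// in ww'.
have -> : dot l w - dot (u n) w =
    dot (l - u n) (w - w') + (dot l w' - dot (u n) w').
  by rewrite !(dotE dot); ring.
rewrite (le_trans (ler_normD _ _))// [leRHS](splitr e) lerD//.
rewrite (le_trans (cauchy_schwarz hdot _ _))// (le_trans _ (ltW ww'))//.
rewrite mulrC ler_wpM2l// (le_trans (ler_normB _ _))// /B.
by have := uM n; lra.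
Qed.

(* An ultrafilter finer than \oo yields a weak limit [l] along it by Riesz; phi is
   chosen so that u (phi k) is close to l when tested against u 0, ..., u k.  The
   vectors against which u \o phi converges to l form a closed subspace S
   containing the u j; whatever is orthogonal to S is orthogonal to every u j and
   to l, hence lies in S as well. *)
Lemma weak_sequential_compactness u M : (forall n, `|u n| <= M) ->
  exists (phi : nat -> nat) l,
    (forall k, (k <= phi k)%N) /\ weak_cvg dot (u \o phi) l.
Proof.
move=> uM.
have [U [uU ooU]] := ultraFilterLemma (_ : ProperFilter (\oo : set_system nat)).
have [l ul] := ultra_weak_limit uU uM.
(* Each condition holds on a set of [U], and so do finitely many together. The map [phi] so chosen
   need not be increasing; [k <= phi k] is enough to reach infinity. *)
have approx k : exists n, (k <= n)%N /\
    forall j : 'I_k.+1, `|dot l (u j) - dot (u n) (u j)| <= k.+1%:R^-1.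
  have /filter_ex// : \forall n \near U, (k <= n)%N /\
    forall j : 'I_k.+1, `|dot l (u j) - dot (u n) (u j)| <= k.+1%:R^-1.
  apply: filterI; first by apply: ooU; exists k.
  apply: filter_forall => j.
  by move/cvgrPdist_le : (ul (u j)); apply; rewrite invr_gt0.
have [phi /all_and2[phi_ge phi_near]] := choice approx.
exists phi, l; split => //.
pose S := [set w | dot (u (phi k)) w @[k --> \oo] --> dot l w].
have S_lin a v b w : S v -> S w -> S (a *: v + b *: w).
  move=> Sv Sw; rewrite /S /= !(dotE dot).
  rewrite (_ : (fun k => _) =
      fun k => a * dot (u (phi k)) v + b * dot (u (phi k)) w).
    by apply: cvgD; apply: cvgM => //; exact: cvg_cst.
  by apply/funext => n; rewrite !(dotE dot).
have S_u j : S (u j).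
  apply/cvgrPdist_le => e e0; near=> k.
  have jk : (j < k.+1)%N by rewrite ltnS; near: k; exists j.
  rewrite (le_trans (phi_near k (Ordinal jk)))// ltW//.
  by near: k; exact: (near_infty_natSinv_lt (PosNum e0)).
have S_closed : closed S by apply: (@weak_cvg_closed _ _ M) => n; exact: uM.
have S_convex : convex_set S.
  by move=> v w t; rewrite !inE => Sv Sw; exact: S_lin.
move=> v.
have [q [Sq minq]] : exists q, is_proj S v q.
  by apply: proj_exists => //; exists (u 0%N).
(* As [S] is a subspace, [q + w] and [q - w] both compete with [q], which turns the inequality into
   an equality. *)
have perp w : S w -> dot (v - q) w = 0.
  move=> Sw; have var := proj_variational hdot S_convex (conj Sq minq).
  have := var _ (S_lin 1 q 1 w Sq Sw); have := var _ (S_lin 1 q (-1) w Sq Sw).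
  by rewrite !scale1r scaleN1r !(addrC q) !addrK dotNr; lra.
have Svq : S (v - q).
  have uperp n : dot (u n) (v - q) = 0 by rewrite dotC; exact: perp.
  have lperp : dot l (v - q) = 0.
    apply: (cvg_unique _ (ul (v - q))) => //=.
    by under eq_fun do rewrite uperp; exact: cvg_cst.
  by rewrite /S /= lperp; under eq_fun do rewrite uperp; exact: cvg_cst.
by have := S_lin 1 (v - q) 1 q Svq Sq; rewrite !scale1r subrK.
Unshelve. all: by end_near. Qed.

End WeakCompactness.

(** * Proximal steps of an equilibrium bifunction *)

Section Bifunction.
Variables (R : realType) (H : normedModType R) (dot : {dot H for idfun}).
Hypothesis hdot : induces_norm dot.
Variables (f : H -> H -> R) (c1 c2 : R).
Hypotheses (f_pseudomonotone : pseudomonotone f)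
  (f_lipschitz : lipschitz_type c1 c2 f)
  (f_convex : forall u, convex_function [set: H] (f u)).

(** The Lipschitz-type condition at three equal points reads [f u u <= f u u + f u u];
    pseudomonotonicity then gives the opposite sign. *)
Lemma bifunction_diag0 u : f u u = 0.
Proof.
have ge0 : 0 <= f u u.
  by have := f_lipschitz u u u; rewrite subrr normr0 expr0n /= !mulr0 !subr0; lra.
by apply/le_anti; rewrite ge0 andbT f_pseudomonotone.
Qed.

Lemma prox_variational (K : set H) (l : R) x a y : 0 <= l -> convex_set K ->
  is_argmin K (prox_objective f l x a) y ->
  forall w, K w -> dot (x - y) (w - y) <= l * (f a w - f a y).
Proof.
move=> l0 cK miny w Kw; rewrite mulrBr.
apply: (argmin_prox_variational hdot cK (g := fun y => l * f a y)) => //.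
move=> t u v; rewrite !inE => _ _.
have := f_convex a t; move=> /(_ u v); rewrite !inE => /(_ I I) /(ler_wpM2l l0).
by move=> /le_trans; apply; rewrite !convRE mulrDr !(mulrCA l).
Qed.

(* The sum of the two proximal inequalities, combined through pseudomonotonicity
   at the solution and the Lipschitz-type condition. *)
Lemma extragradient_fejer (K : set H) (l : R) x y z p : 0 <= l -> convex_set K ->
  is_argmin K (prox_objective f l x x) y ->
  is_argmin K (prox_objective f l x y) z ->
  EP K f p ->
  `|z - p| ^+ 2 <= `|x - p| ^+ 2 - (1 - 2 * l * c1) * `|x - y| ^+ 2
                   - (1 - 2 * l * c2) * `|y - z| ^+ 2.
Proof.
move=> l0 cK miny minz [Kp EPp].
(* The inequality for [y] is tested at [z], the one for [z] at [p]. In their sum the term [f y p] is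
   nonpositive, and [f x z - f x y - f y z] is bounded by the Lipschitz-type condition. *)
have := prox_variational l0 cK miny minz.1.
have := prox_variational l0 cK minz Kp.
have := ler_wpM2l l0 (f_pseudomonotone (EPp _ miny.1)).
have := ler_wpM2l l0 (f_lipschitz x y z).
rewrite -!hdot !(dotE dot).
by rewrite (dotC dot p x) (dotC dot y x) (dotC dot z y) (dotC dot p z); lra.
Qed.

End Bifunction.

(** * Geometry of the half-spaces of the algorithm *)

Section HalfSpaces.
Variables (R : realType) (H : normedModType R) (dot : {dot H for idfun}).
Hypothesis hdot : induces_norm dot.
Implicit Types (x z p w : H) (g : R).

Lemma convex_setI (A B : set H) :
  convex_set A -> convex_set B -> convex_set (A `&` B).
Proof.
move=> cA cB a b t; rewrite !inE => -[Aa Ba] [Ab Bb].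
by split; [have := cA a b t | have := cB a b t]; rewrite !inE; apply.
Qed.

Lemma convex_bigcap (I : Type) (A : I -> set H) :
  (forall i, convex_set (A i)) -> convex_set (\bigcap_i A i).
Proof.
move=> cA a b t; rewrite !inE => Aa Ab i _.
by have := cA i a b t; rewrite !inE; apply; [exact: Aa | exact: Ab].
Qed.

Lemma convex_halfspace (u : H) (r : R) : convex_set [set w | dot u w <= r].
Proof.
move=> a b t; rewrite !inE /= => ua ub.
rewrite /conv /= /unstable.onem !(dotE dot).
have t0 : 0 <= t%:num by [].
have t1 : t%:num <= 1 by [].
by nra.
Qed.

(** This normal form, like the next one, lets [convex_halfspace] apply. *)
Lemma cut_halfspaceE x z g : cut_halfspace dot x z g =
  [set w | dot (x - z) w <= dot (x - z) (x + g *: (z - x))].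
Proof.
by apply/seteqP; split => w /=; rewrite /cut_halfspace /= !(dotE dot); lra.
Qed.

Lemma outer_halfspaceE x z : outer_halfspace dot x z =
  [set w | dot (x - z) w <= dot (x - z) z].
Proof.
by apply/seteqP; split => w /=; rewrite /outer_halfspace /= !(dotE dot); lra.
Qed.

(** For [g = 2^-1] the cut consists of the points at least as close to [z] as to [x]; a smaller [g]
    only enlarges it. *)
Lemma mem_cut_halfspace x z p g : g <= 2^-1 -> `|z - p| ^+ 2 <= `|x - p| ^+ 2 ->
  cut_halfspace dot x z g p.
Proof.
move=> g2; rewrite -!hdot.
have := ler_wpM2r (dot_ge0 hdot (x - z)) g2.
rewrite /cut_halfspace /= !(dotE dot) (dotC dot p x) (dotC dot p z) (dotC dot z x).
lra.
Qed.

(** The bounding hyperplane lies at distance [g * |x - z|] from [x]: membership gives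
    [g * |x - z|^2 <= dot (x - z) (x - w)], and Cauchy-Schwarz concludes. *)
Lemma cut_halfspace_dist x z w g : 0 <= g -> cut_halfspace dot x z g w ->
  g * `|x - z| <= `|w - x|.
Proof.
move=> g0 cut.
have [->|xz] := eqVneq (`|x - z|) 0; first by rewrite mulr0.
have xz0 : 0 < `|x - z| by rewrite lt_def xz normr_ge0.
rewrite -(ler_pM2l xz0) -[`|w - x|]normrN.
apply: le_trans (cauchy_schwarz hdot _ _).
apply: le_trans (ler_norm _); rewrite mulrCA -expr2 -hdot.
by move: cut; rewrite /cut_halfspace /= !(dotE dot) (dotC dot z x); lra.
Qed.

(** In the expansion of [|(x0 - x) + (x - w)|^2] the cross term is nonnegative. *)
Lemma outer_halfspace_dist x0 x w : outer_halfspace dot x0 x w ->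
  `|w - x| ^+ 2 + `|x0 - x| ^+ 2 <= `|x0 - w| ^+ 2.
Proof.
rewrite -!hdot /outer_halfspace /= !(dotE dot).
rewrite (dotC dot x x0) (dotC dot w x) (dotC dot w x0); lra.
Qed.

End HalfSpaces.

(** * Passage to strong and weak limits *)

Section Limits.
Variables (R : realType) (H : completeNormedModType R) (dot : {dot H for idfun}).
Hypothesis hdot : induces_norm dot.

Lemma sqr_cvg0 (u : nat -> R) :
  u n ^+ 2 @[n --> \oo] --> 0 -> u n @[n --> \oo] --> 0.
Proof.
move=> u0; apply/cvgr0Pnorm_lt => e e0.
have e2 : 0 < e ^+ 2 by exact: exprn_gt0.
move/cvgr0Pnorm_lt : u0 => /(_ _ e2); apply: filterS => n.
by rewrite normrX ltr_sqr ?nnegrE// ltW.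
Qed.

Lemma cvg_dist0 (u v : nat -> H) (l : H) :
  u n @[n --> \oo] --> l -> `|u n - v n| @[n --> \oo] --> 0 ->
  v n @[n --> \oo] --> l.
Proof.
move=> ul /norm_cvg0 uv; rewrite (_ : v = fun n => u n - (u n - v n)); last first.
  by apply/funext => n; rewrite subKr.
by rewrite -[l]subr0; exact: cvgB.
Qed.

(** Weak lower semicontinuity, obtained by bounding [dot (a - u n) (a - l)] by half the sum of the
    two squares and passing to the limit. *)
Lemma weak_limit_dist_le (u : nat -> H) (a l : H) (s : R) : weak_cvg dot u l ->
  (forall n, `|a - u n| ^+ 2 <= s) -> `|a - l| ^+ 2 <= s.
Proof.
move=> ul us.
have lim : dot a (a - l) - dot (u n) (a - l) @[n --> \oo] --> dot (a - l) (a - l).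
  by rewrite [X in _ --> X]dotBl; apply: cvgB; [exact: cvg_cst | exact: ul].
suff : dot (a - l) (a - l) <= 2^-1 * (s + `|a - l| ^+ 2) by rewrite -hdot; lra.
apply: (cvgr_to_le lim); apply: nearW => n; rewrite -dotBl.
have := us n; have := dot_ge0 hdot ((a - u n) - (a - l)); rewrite -!hdot.
by move: (a - u n) (a - l) => v w; rewrite !(dotE dot) (dotC dot w v); lra.
Qed.

(** The proximal inequality bounds [f (x n) w - f (x n) (y n)] below by a quantity vanishing with
    [|x n - y n|]; weak continuity sends the difference to [f l w - f l l], where [f l l = 0]. *)
Lemma weak_limit_EP (K : set H) (f : H -> H -> R) (c1 c2 lambda M : R)
    (lam : nat -> R) (x y : nat -> H) (l : H) :
  closed K -> convex_set K -> pseudomonotone f -> lipschitz_type c1 c2 f ->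
  weakly_continuous dot f -> (forall u, convex_function [set: H] (f u)) ->
  0 < lambda -> (forall n, lambda <= lam n) ->
  (forall n, is_argmin K (prox_objective f (lam n) (x n) (x n)) (y n)) ->
  (forall n, `|x n| <= M) -> `|x n - y n| @[n --> \oo] --> 0 ->
  weak_cvg dot x l -> EP K f l.
Proof.
move=> clK cK f1 f2 f3 f4 lambda0 lam_ge miny xM xy xl.
have yl : weak_cvg dot y l.
  by apply: weak_cvg_dist0 xl _ => //; under eq_fun do rewrite distrC.
split.
  by apply: (closed_convex_weak_closed hdot clK cK _ yl) => n; exact: (miny n).1.
move=> w Kw; pose q n := `|x n - y n|.
have lim : f (x n) w - f (x n) (y n) + lambda^-1 * (q n * (`|w| + M + q n))
    @[n --> \oo] --> f l w.
  have -> : f l w = f l w - f l l + lambda^-1 * (0 * (`|w| + M + 0)).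
    by rewrite (bifunction_diag0 f1 f2); ring.
  apply: cvgD; first apply: cvgB.
  - by apply: f3 => //; exact: cst_weak_cvg.
  - exact: f3.
  - apply: cvgM; first exact: cvg_cst.
    by apply: cvgM => //; apply: cvgD => //; exact: cvg_cst.
apply: (cvgr_to_ge lim); apply: nearW => n /=.
have lam0 : 0 < lam n by exact: lt_le_trans (lam_ge n).
have := prox_variational hdot f4 (ltW lam0) cK (miny n) Kw.
have dot_bound : - (q n * (`|w| + M + q n)) <= dot (x n - y n) (w - y n).
  rewrite lerNl -dotNl (le_trans (ler_norm _))//.
  rewrite (le_trans (cauchy_schwarz hdot _ _))//.
  rewrite normrN ler_wpM2l// (_ : w - y n = w - x n + (x n - y n)); last first.
    by rewrite addrA subrK.
  rewrite (le_trans (ler_normD _ _))// lerD2r (le_trans (ler_normB _ _))//.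
  by rewrite lerD2l.
move=> /(le_trans dot_bound); move: (f (x n) w - f (x n) (y n)) => D.
have q0 : 0 <= q n * (`|w| + M + q n).
  by rewrite /q mulr_ge0// !addr_ge0// (le_trans _ (xM 0%N)).
(* For negative [D], lowering [lam n] to [lambda] only increases the product with [D], so
   [lambda * D] still dominates [- Q]. *)
move: (q n * _) q0 => Q Q0 QD; have [D0|D0] := leP 0 D.
  by rewrite addr_ge0// mulr_ge0// invr_ge0 ltW.
rewrite -(pmulr_rge0 _ lambda0) mulrDr mulrA mulfV ?gt_eqF// mul1r.
by have := lam_ge n; nra.
Qed.

End Limits.

(** * Strong convergence of an infinite run *)

Theorem theorem3p6 (R : realType) (H : completeNormedModType R)
    (dot : {dot H for idfun}) (hdot : induces_norm dot)
    (N : nat) (N_gt0 : (0 < N)%N)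
    (K : 'I_N -> set H)
    (K_closed : forall i, closed (K i))
    (K_convex : forall i, convex_set (K i))
    (K_neq0 : \bigcap_i K i !=set0)
    (f : 'I_N -> H -> H -> R)
    (c1 c2 : R) (c1_gt0 : 0 < c1) (c2_gt0 : 0 < c2)
    (A1 : forall i, pseudomonotone (f i))
    (A2 : forall i, lipschitz_type c1 c2 (f i))
    (A3 : forall i, weakly_continuous dot (f i))
    (A4 : forall i u, convex_function [set: H] (f i u) /\
                      subdifferentiable dot (f i u))
    (F_neq0 : \bigcap_i EP (K i) (f i) !=set0)
    (lambda mu eps : R) (lam gam : 'I_N -> nat -> R)
    (eps_gt0 : 0 < eps) (eps_le : eps <= 2^-1)
    (lambda_gt0 : 0 < lambda)
    (mu_lt : mu < Num.min (1 / (2 * c1)) (1 / (2 * c2)))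
    (lam_bounds : forall i n, lambda <= lam i n <= mu)
    (gam_bounds : forall i n, eps <= gam i n <= 2^-1)
    (x0 : H) (x : nat -> H) (y z : 'I_N -> nat -> H)
    (run : hybrid_extragradient_cutting dot K f lam gam x0 x y z) :
  exists p : H,
    [/\ is_proj (\bigcap_i EP (K i) (f i)) x0 p,
        x n @[n --> \oo] --> p,
        forall i, y i n @[n --> \oo] --> p &
        forall i, z i n @[n --> \oo] --> p].
Proof.
case: run => x_start miny minz xproj _.
have [l0 l_gt0] : (forall i n, 0 <= lam i n) /\ (forall i n, lambda <= lam i n).
  split=> i n; have /andP[h1 h2] := lam_bounds i n => //.
  exact: le_trans (ltW lambda_gt0) h1.
have [mu1 mu2] : 0 < 1 - 2 * mu * c1 /\ 0 < 1 - 2 * mu * c2.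
  move: mu_lt; rewrite lt_min => /andP[].
  by rewrite !ltr_pdivlMr ?mulr_gt0// => m1 m2; split; lra.
pose k := 1 - 2 * mu * c1; have k_gt0 : 0 < k by [].
pose F := \bigcap_i EP (K i) (f i).
(* Replacing [lam i n] by its bound [mu] gives a constant [k] independent of [i] and [n]; the term
   in [|y i n - z i n|] has a favourable sign and is dropped. *)
have fejer i n p : F p ->
    `|z i n - p| ^+ 2 <= `|x n - p| ^+ 2 - k * `|x n - y i n| ^+ 2.
  move=> Fp.
  have := extragradient_fejer hdot (A1 i) (A2 i) (fun u => proj1 (A4 i u))
    (l0 i n) (K_convex i) (miny n i) (minz n i) (Fp i I).
  have /andP[_ lm] := lam_bounds i n.
  have := sqr_ge0 (`|x n - y i n|); have := sqr_ge0 (`|y i n - z i n|).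
  move: (`|x n - y i n| ^+ 2) (`|y i n - z i n| ^+ 2) => s t t0 s0.
  have h1 : 0 <= (mu - lam i n) * c1 * s by rewrite !mulr_ge0// ?subr_ge0// ltW.
  have h2 : 0 <= (mu - lam i n) * c2 * t by rewrite !mulr_ge0// ?subr_ge0// ltW.
  have h3 : 0 <= (1 - 2 * mu * c2) * t by rewrite mulr_ge0// ltW.
  by rewrite /k; lra.
have fejer_dist i n p : F p -> `|z i n - p| <= `|x n - p|.
  move=> Fp; rewrite -ler_sqr ?nnegrE// (le_trans (fejer i n p Fp))//.
  by rewrite gerBl mulr_ge0// ?sqr_ge0// ltW.
have F_cut n : F `<=` \bigcap_i cut_halfspace dot (x n) (z i n) (gam i n).
  move=> p Fp i _; have /andP[_ g2] := gam_bounds i n.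
  by apply: mem_cut_halfspace => //; rewrite ler_sqr ?nnegrE//; exact: fejer_dist.
have F_outer n : F `<=` outer_halfspace dot x0 (x n).
  elim: n => [|n IHn] p Fp.
    by rewrite /outer_halfspace /= x_start subrr dot0l.
  have C_convex : convex_set (\bigcap_i cut_halfspace dot (x n) (z i n) (gam i n)
      `&` outer_halfspace dot x0 (x n)).
    apply: convex_setI; last by rewrite outer_halfspaceE; exact: convex_halfspace.
    by apply: convex_bigcap => i; rewrite cut_halfspaceE; exact: convex_halfspace.
  (* The variational inequality for the projection [x n.+1] of [x0] is membership in the next outer
     half-space. *)
  have := proj_variational hdot C_convex (xproj n) (conj (F_cut n p Fp) (IHn p Fp)).
  by rewrite /outer_halfspace /= -(opprB p) dotNr; lra.
pose a n := `|x0 - x n| ^+ 2.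
have aF n p : F p -> `|p - x n| ^+ 2 + a n <= `|x0 - p| ^+ 2.
  by move=> Fp; apply: outer_halfspace_dist => //; exact: F_outer.
have a_step n : `|x n.+1 - x n| ^+ 2 <= a n.+1 - a n.
  by rewrite lerBrDr; apply: outer_halfspace_dist => //; exact: (xproj n).1.2.
have [q Fq] := F_neq0.
have a_ndecr : {homo a : n m / (n <= m)%N >-> n <= m}.
  apply/nondecreasing_seqP => n.
  by rewrite -subr_ge0 (le_trans _ (a_step n))// sqr_ge0.
have a_ub : has_ubound (range a).
  exists (`|x0 - q| ^+ 2) => _ [n _ <-]; apply: le_trans (aF n q Fq).
  by rewrite lerDr sqr_ge0.
pose s := sup (range a).
have a_cvg : a n @[n --> \oo] --> s by exact: nondecreasing_cvgn.
have a_le n : a n <= s by apply: ub_le_sup => //; exists n.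
have x_step : `|x n.+1 - x n| @[n --> \oo] --> 0.
  apply: sqr_cvg0.
  have da : a n.+1 - a n @[n --> \oo] --> 0.
    by rewrite -[X in _ --> X](subrr s); apply: cvgB => //; rewrite (cvg_shiftS a).
  apply: (squeeze_cvgr _ (cvg_cst 0) da); apply: nearW => n.
  by rewrite sqr_ge0 a_step.
have xz i : `|x n - z i n| @[n --> \oo] --> 0.
  have dx : eps^-1 * `|x n.+1 - x n| @[n --> \oo] --> 0.
    by rewrite -[X in _ --> X](mulr0 eps^-1); apply: cvgM => //; exact: cvg_cst.
  apply: (squeeze_cvgr _ (cvg_cst 0) dx); apply: nearW => n.
  rewrite normr_ge0 /= -(ler_pM2l eps_gt0) mulVKf ?gt_eqF//.
  have /andP[g1 _] := gam_bounds i n; have g0 := le_trans (ltW eps_gt0) g1.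
  apply: (le_trans _ (cut_halfspace_dist hdot g0 ((xproj n).1.1 i I))).
  by rewrite ler_wpM2r.
have xq n : `|x n - q| <= `|x0 - q|.
  rewrite -ler_sqr ?nnegrE// distrC (le_trans _ (aF n q Fq))//.
  by rewrite lerDl sqr_ge0.
have xy i : `|x n - y i n| @[n --> \oo] --> 0.
  apply: sqr_cvg0.
  have dz : k^-1 * (2 * `|x0 - q| * `|x n - z i n|) @[n --> \oo] --> 0.
    rewrite -[X in _ --> X](mulr0 (k^-1 * (2 * `|x0 - q|))).
    under eq_fun do rewrite mulrA.
    by apply: cvgM => //; exact: cvg_cst.
  apply: (squeeze_cvgr _ (cvg_cst 0) dz); apply: nearW => n.
  rewrite sqr_ge0 /= -(ler_pM2l k_gt0) mulVKf ?gt_eqF//.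
  (* The difference of squares [|x n - q|^2 - |z i n - q|^2] factors: one factor is at most
     [|x n - z i n|], the other at most [2 * |x0 - q|]. *)
  have := fejer i n q Fq; have := fejer_dist i n q Fq; have := xq n.
  have : `|x n - q| <= `|x n - z i n| + `|z i n - q|.
    by rewrite (le_trans _ (ler_normD _ _))// addrA subrK.
  have := normr_ge0 (x n - z i n); have := normr_ge0 (z i n - q).
  move: (`|x n - q|) (`|z i n - q|) (`|x n - z i n|) (`|x0 - q|) => b c d e.
  move: (k * _) => r c0 d0 bdc be cb; nra.
have xM n : `|x n| <= `|q| + `|x0 - q|.
  by rewrite -[x n](subrK q) addrC (le_trans (ler_normD _ _))// lerD2l.
have [phi [l [phi_ge xl]]] := weak_sequential_compactness hdot xM.
have phi_cvg : phi n @[n --> \oo] --> \oo.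
  apply/cvgnyPge => A; exists A => // n; move/leq_trans; exact.
have Fl : F l.
  move=> i _.
  apply: (weak_limit_EP hdot (K_closed i) (K_convex i) (A1 i) (A2 i) (A3 i)
    (fun u => proj1 (A4 i u)) lambda_gt0 (lam := lam i \o phi) _ _ _ _ xl).
  - by move=> n; exact: l_gt0.
  - by move=> n; exact: miny.
  - by move=> n; exact: xM.
  - exact: cvg_comp phi_cvg (xy i).
have x0l : `|x0 - l| ^+ 2 <= s.
  by apply: (weak_limit_dist_le hdot xl) => n; exact: a_le.
have x_cvg : x n @[n --> \oo] --> l.
  apply: (cvg_dist0 (cvg_cst l)); apply: sqr_cvg0.
  have da : s - a n @[n --> \oo] --> 0.
    by rewrite -[X in _ --> X](subrr s); apply: cvgB => //; exact: cvg_cst.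
  apply: (squeeze_cvgr _ (cvg_cst 0) da); apply: nearW => n.
  (* Since [l] is itself a solution, [aF] applies to it and bounds [|l - x n|^2] by [s - a n] for
     every [n], not only along [phi]. *)
  by rewrite sqr_ge0 /= lerBrDr (le_trans (aF n l Fl)).
exists l; split=> // [|i|i].
- split=> // p Fp; rewrite -ler_sqr ?nnegrE// (le_trans x0l)//.
  apply: (cvgr_to_le a_cvg); apply: nearW => n.
  by rewrite (le_trans _ (aF n p Fp))// lerDr sqr_ge0.
- exact: cvg_dist0 x_cvg (xy i).
- exact: cvg_dist0 x_cvg (xz i).
Qed.
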